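(* Let $B=(V,E)$ be a generalized stationary Bratteli diagram with an irreducible aperiodic incidence matrix $F=(f_{ij})_{i,j\in\mathbb Z}$. Then the tail equivalence relation $\mathcal R$ on $X_B$ is topologically transitive.
   Context: A generalized Bratteli diagram is a graded graph $B=(V,E)$ with $V=\bigsqcup_{i\ge0}V_i$, $E=\bigsqcup_{i\ge0}E_i$, where every level $V_i$ is countably infinite, $E_i$ is a countable set of edges from $V_i$ to $V_{i+1}$ with source and range maps $s,r$ satisfying $s(E_i)=V_i$, $r(E_i)=V_{i+1}$, and $|r^{-1}(v)|<\infty$ for every $v\in V\setminus V_0$. The path space $X_B$ is the set of infinite paths $x=(x_i)_{i\ge0}$, $x_i\in E_i$, $r(x_i)=s(x_{i+1})$, with the topology generated by the cylinder sets $[\overline e]=\{x: x_0=e_0,\dots,x_n=e_n\}$. The diagram is stationary with incidence matrix $F$ if every level is identified with $\mathbb Z$ and, for every $n\ge0$, the number of edges from $w\in V_n$ to $v\in V_{n+1}$ is $f_{vw}$ (so every row of $F$ has finitely many nonzero entries, and no row or column is zero). Write $f^{(n)}_{ij}$ for the entries of $F^n$. $F$ is irreducible if for all $i,j$ there is $n>0$ with $f^{(n)}_{ij}>0$; an irreducible $F$ is aperiodic if $\gcd\{n:f^{(n)}_{ii}>0\}=1$ (this does not depend on $i$). Paths $x,y\in X_B$ are tail equivalent, $(x,y)\in\mathcal R$, if there is $n$ with $x_i=y_i$ for all $i\ge n$. $\mathcal R$ is topologically transitive if there is $x\in X_B$ whose class $[x]_{\mathcal R}$ is dense in $X_B$.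 *)

(* Defs.v *)
From HB Require Import structures.
From mathcomp Require Import all_boot all_algebra all_classical.
From mathcomp Require Import topology.

Set Implicit Arguments.
Unset Strict Implicit.
Unset Printing Implicit Defensive.

Local Open Scope classical_set_scope.
Local Open Scope card_scope.

(* The graded sets V = \bigsqcup_i V_i and E = \bigsqcup_i E_i are given by
   families of types, so levels are disjoint by construction. *)
Record gen_bratteli := GenBratteli {
  vertex : nat -> Type;
  edge : nat -> Type;
  src : forall i, edge i -> vertex i;
  rng : forall i, edge i -> vertex i.+1;
  vertex_countably_infinite : forall i, [set: vertex i] #= [set: nat];
  edge_countable : forall i, countable [set: edge i];
  src_surj : forall i, range (@src i) = [set: vertex i];
  rng_surj : forall i, range (@rng i) = [set: vertex i.+1];
  rng_finite : forall i (v : vertex i.+1), finite_set [set e | rng e = v]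
}.

Record path_space (B : gen_bratteli) := PathSpace {
  path_edge :> forall i, edge B i;
  path_edgeP : forall i, rng (path_edge i) = src (path_edge i.+1)
}.

(* The finite path (e_0, ..., e_n) is represented by any sequence of edges
   extending it; only the indices up to n matter. *)
Definition finite_path (B : gen_bratteli) (n : nat)
    (e : forall i, edge B i) : Prop :=
  forall i, (i < n)%N -> rng (e i) = src (e i.+1).

Definition cylinder (B : gen_bratteli) (n : nat)
    (e : forall i, edge B i) : set (path_space B) :=
  [set x : path_space B | forall i, (i <= n)%N -> x i = e i].

Definition cylinders (B : gen_bratteli) : set (set (path_space B)) :=
  [set C | exists n e, finite_path n e /\ C = cylinder n e].

HB.instance Definition _ (B : gen_bratteli) := gen_eqMixin (path_space B).
HB.instance Definition _ (B : gen_bratteli) := gen_choiceMixin (path_space B).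
HB.instance Definition _ (B : gen_bratteli) :=
  @isSubBaseTopological.Build (path_space B)
    (set (path_space B)) (@cylinders B) id.

(* phi n identifies V_n with Z; the row index of F is the range of the edge. *)
Definition stationary (B : gen_bratteli) (F : int -> int -> nat) : Prop :=
  exists phi : forall n, vertex B n -> int,
    (forall n, bijective (phi n)) /\
    forall n (w : vertex B n) (v : vertex B n.+1),
      [set e : edge B n | src e = w /\ rng e = v]
        #= `I_(F (phi n.+1 v) (phi n w)).

(* The sum over int is finite when the rows of F are finitely supported, which
   holds for the incidence matrix of a stationary diagram by rng_finite. *)
Fixpoint mxpow (F : int -> int -> nat) (n : nat) (i j : int) : nat :=
  if n is m.+1
  then (\big[addn/0]_(k \in [set: int]) (F i k * mxpow F m k j))%N
  else (i == j).

Definition irreducible_mx (F : int -> int -> nat) : Prop :=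
  forall i j, exists2 n, (0 < n)%N & (0 < mxpow F n i j)%N.

Definition is_gcd (A : set nat) (d : nat) : Prop :=
  (forall n, A n -> (d %| n)%N) /\
  forall m, (forall n, A n -> (m %| n)%N) -> (m %| d)%N.

Definition aperiodic_mx (F : int -> int -> nat) : Prop :=
  forall i, is_gcd [set n | (0 < n)%N /\ (0 < mxpow F n i i)%N] 1.

Definition tail_equivalent (B : gen_bratteli) (x y : path_space B) : Prop :=
  exists n, forall i, (n <= i)%N -> x i = y i.

Definition topologically_transitive (X : topologicalType)
    (R : X -> X -> Prop) : Prop :=
  exists x, dense [set y | R x y].

(* Main.v *)
Require Import Defs.
From mathcomp Require Import all_boot all_algebra all_classical.
From mathcomp Require Import topology.
From mathcomp Require Import finmap zify.

Local Open Scope classical_set_scope.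

(** By irreducibility there is a closed walk through the vertex 0, so there is
a path x of the diagram whose vertex sequence is periodic and which therefore
visits 0 at infinitely many levels.  The class of x is dense: let v be the
vertex at level m reached by some finite path.  The lengths of closed walks at
0 form an additive set whose gcd is 1 by aperiodicity, so every large number
is such a length ([submonoid_cofinite]).  Following a walk from v to 0 by
closed walks at 0, one gets walks from v to 0 of every large length
([walk_large]); in particular there is one that meets x at one of its visits
to 0.  The finite path, this connecting walk and the tail of x then make up a
path tail equivalent to x ([splice]).

The hypotheses on F enter through walks along its positive entries: a positive
entry of F^n yields a walk of length n ([mxpow_walk]), and concatenating walks
replaces multiplying the matrices, whose entries are sums over all integers. *)

(** * Additive sets of natural numbers *)

(** The least positive difference d of two elements divides every element t:
otherwise, writing t = q d + r with 0 < r < d, the elements t + q a and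
q (a + d) would differ by r.  Hence d = 1, so the set contains some a and
a + 1.  If a > 0, every n >= a ^ 2 is (n %/ a - n %% a) a + (n %% a) (a + 1);
if a = 0, the set contains 1. *)
Lemma submonoid_cofinite (T : set nat) :
    T 0 -> (forall m n, T m -> T n -> T (m + n)) ->
    (forall d, (forall n, T n -> d %| n) -> d %| 1) ->
  exists N, forall n, N <= n -> T n.
Proof.
move=> T0 TD gcdT.
have TM k n : T n -> T (k * n).
  by move=> Tn; elim: k => [|k IH]; rewrite ?mulSn//; exact: TD.
have diffT : exists d, `[<0 < d /\ exists a, T a /\ T (a + d)>].
  apply: contrapT => noT.
  suff: 2 %| 1 by [].
  apply: gcdT => -[|n] // Tn.
  by case: noT; exists n.+1; apply/asboolP; split=> //; exists 0.
case: (ex_minnP diffT) => d /asboolP[d0 [a [Ta Tad]]] dmin.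
have d1 : d %| 1.
  apply: gcdT => t Tt; rewrite /dvdn; apply/negPn/negP => r0.
  have := ltn_pmod t d0; rewrite ltnNge => /negP; apply.
  apply: dmin; apply/asboolP; split; first by rewrite lt0n.
  exists (t %/ d * (a + d)); split; first exact: TM.
  have -> : t %/ d * (a + d) + t %% d = t %/ d * a + t.
    by rewrite mulnDr -addnA -divn_eq.
  by apply: TD => //; exact: TM.
move: d1 Tad; rewrite dvdn1 => /eqP ->; rewrite addn1 => Ta1 {d d0 dmin}.
exists (a * a) => n an.
have [a0|a0] := posnP a.
  by rewrite -[n]muln1; apply: TM; rewrite -a0.
have ra := ltn_pmod n a0.
have aq : a <= n %/ a by rewrite leq_divRL.
have -> : n = (n %/ a - n %% a) * a + n %% a * a.+1.
  rewrite mulnS [_ %% a + _]addnC addnA -mulnDl subnK -?divn_eq//.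
  exact: leq_trans (ltnW ra) aq.
by apply: TD; exact: TM.
Qed.

(** * Walks along positive entries *)

(** The orientation is that of the diagram, where F i j counts edges from j
to i. *)
Definition walk (F : int -> int -> nat) (n : nat) (j i : int) : Prop :=
  exists u : nat -> int,
    [/\ u 0 = j, u n = i & forall k, k < n -> 0 < F (u k.+1) (u k)].

Lemma walk0 F i : walk F 0 i i.
Proof. by exists (fun=> i). Qed.

Lemma walk_cat {F m n} j k {i} :
  walk F m j k -> walk F n k i -> walk F (m + n) j i.
Proof.
move=> [u [u0 um uF]] [w [w0 wn wF]].
pose c l := if l <= m then u l else w (l - m).
have cw l : m <= l -> c l = w (l - m).
  rewrite /c leq_eqVlt => /predU1P[<-|ml]; last by rewrite leqNgt ml.
  by rewrite leqnn subnn w0.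
exists c; split; first by rewrite /c u0.
  by rewrite cw ?leq_addr// addKn.
move=> l lmn; have [lm|ml] := ltnP l m.
  by rewrite /c lm (ltnW lm); exact: uF.
rewrite !cw ?(leqW ml)// subSn//; apply: wF; lia.
Qed.

Lemma mxpow_walk F n i j : 0 < mxpow F n i j -> walk F n j i.
Proof.
elim: n i => [|n IH] i /=; first by case: eqP => // -> _; exact: walk0.
rewrite lt0n => /(@fsbigN1 _ _ _ _ _ _ (fun _ k => F i k * mxpow F n k j) tt).
move=> [k _]; rewrite -lt0n muln_gt0 => /andP[Fik /IH jk].
rewrite -addn1; apply: (walk_cat j k) => //.
by exists (fun l => if l is 0 then k else i); split=> // -[].
Qed.

(** The lengths of closed walks at i have gcd 1, since they include the n with
0 < mxpow F n i i. *)
Lemma walk_large F : irreducible_mx F -> aperiodic_mx F ->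
  forall j i, exists N, forall n, N <= n -> walk F n j i.
Proof.
move=> irrF aperF j i.
have [N largeN] : exists N, forall n, N <= n -> walk F n i i.
  apply: submonoid_cofinite => [|m n|d dT]; first exact: walk0.
  - exact: walk_cat.
  - by apply: (aperF i).2 => n [_ /mxpow_walk]; exact: dT.
have [m _ /mxpow_walk ji] := irrF i j.
exists (m + N) => n mNn; rewrite -(subnKC (leq_trans (leq_addr N m) mNn)).
by apply: (walk_cat j i) => //; apply: largeN; lia.
Qed.

(** * Paths of the diagram *)

(** Once the vertices are fixed the edges can be chosen level by level
independently; Q records which of them are prescribed. *)
Lemma path_choice {B} (s : forall i, vertex B i)
    (Q : forall i, edge B i -> Prop) :
    (forall i, exists e, [/\ src e = s i, rng e = s i.+1 & Q i e]) ->
  exists x : path_space B, forall i, src (x i) = s i /\ Q i (x i).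
Proof.
move=> sQ; pose e i := projT1 (cid (sQ i)).
have eP i : [/\ src (e i) = s i, rng (e i) = s i.+1 & Q i (e i)].
  exact: projT2 (cid (sQ i)).
have eE i : rng (e i) = src (e i.+1) by case: (eP i); case: (eP i.+1) => ->.
by exists (PathSpace eE) => i; case: (eP i).
Qed.

(** Cylinders along z are nested, so a finite intersection of cylinders
containing z contains the longest of the corresponding cylinders along z. *)
Lemma open_cylinder {B} (O : set (path_space B)) (z : path_space B) :
  open O -> O z -> exists n, cylinder n z `<=` O.
Proof.
move=> oO.
(* This is what openness in the topology generated by the cylinders unfolds
   to. *)
have [D sD <-] : exists2 D : set (set (path_space B)),
    D `<=` finI_from (@cylinders B) id & \bigcup_(C in D) C = O by exact: oO.
move=> [I DI Iz]; have [A sA AI] := sD _ DI.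
suff [n nA] : exists n, forall C, C \in A -> cylinder n z `<=` C.
  exists n => y zy; exists I => //; rewrite -AI => C CA; exact: nA zy.
have bound C : exists n, C \in A -> cylinder n z `<=` C.
  have [CA|CA] := boolP (C \in A); last by exists 0.
  have /set_mem[n [e [_ CE]]] := sA _ CA.
  exists n => _ y zy; have := Iz; rewrite -AI => /(_ _ CA); rewrite /= CE => ze i ni.
  by rewrite zy// ze.
have [f fP] := choice bound.
exists (\max_(C <- enum_fset A) f C) => C CA y zy.
apply: (fP C CA) => i ni; apply: zy; apply: leq_trans ni _.
exact: leq_bigmax_seq.
Qed.

Section Stationary.
Variables (B : gen_bratteli) (F : int -> int -> nat).
Variable phi : forall n, vertex B n -> int.
Hypothesis phi_bij : forall n, bijective (phi n).
Hypothesis phiF : forall n (w : vertex B n) (v : vertex B n.+1),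
  ([set e : edge B n | src e = w /\ rng e = v]
     #= `I_(F (phi n.+1 v) (phi n w)))%card.

Lemma edge_exists n (w : vertex B n) (v : vertex B n.+1) :
  0 < F (phi n.+1 v) (phi n w) -> exists e, src e = w /\ rng e = v.
Proof.
move=> Fvw; apply: contrapT => noe.
have := phiF n w v.
have -> : [set e | src e = w /\ rng e = v] = set0.
  by apply/seteqP; split=> // e ewv; apply: noe; exists e.
by rewrite card_eq_sym card_eq0 => /eqP/IIn_eq0 F0; rewrite F0 in Fvw.
Qed.

Lemma vertex_label : exists psi : forall n, int -> vertex B n,
  forall n, cancel (psi n) (phi n).
Proof.
have psi n : {g : int -> vertex B n | cancel g (phi n)}.
  by apply: cid; case: (phi_bij n) => g _ ?; exists g.
by exists (fun n => sval (psi n)) => n; exact: svalP (psi n).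
Qed.

Lemma path_of_walk (u : nat -> int) :
    (forall k, 0 < F (u k.+1) (u k)) ->
  exists x : path_space B, forall i, phi i (src (x i)) = u i.
Proof.
move=> uF; have [psi psiK] := vertex_label.
have [i|x xu] := @path_choice B (fun i => psi i (u i)) (fun _ _ => True).
  have [|e [se re]] := edge_exists i (psi i (u i)) (psi i.+1 (u i.+1)).
    by rewrite !psiK.
  by exists e.
by exists x => i; case: (xu i) => -> _; rewrite psiK.
Qed.

(** A closed walk, run over and over. *)
Lemma periodic_path {p i} : 0 < p -> walk F p i i ->
  exists x : path_space B, forall k, phi (k * p) (src (x (k * p))) = i.
Proof.
move=> p0 [u [u0 up uF]].
have [k|x xu] := path_of_walk (fun k => u (k %% p)); last first.
  by exists x => k; rewrite xu modnMl.
have kp := ltn_pmod k p0.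
suff -> : u (k.+1 %% p) = u (k %% p).+1 by exact: uF.
rewrite -addn1 -modnDml addn1.
by case: (ltngtP (k %% p).+1 p) kp => // [/modn_small ->|->] _;
  rewrite ?modnn ?u0 ?up.
Qed.

(** The vertices come from z up to level m, from the walk up to level m + n and
from x beyond.  Each piece determines the vertex at both ends of its range of
levels, so every edge, old or new, joins vertices given by a single piece. *)
Lemma splice {z x : path_space B} {m n} :
    walk F n (phi m (src (z m))) (phi (m + n) (src (x (m + n)))) ->
  exists y : path_space B,
    (forall i, i < m -> y i = z i) /\ (forall i, m + n <= i -> y i = x i).
Proof.
move=> [u [u0 un uF]]; have [psi psiK] := vertex_label.
have phiK i : cancel (phi i) (psi i).
  by move=> v; apply: (bij_inj (phi_bij i)); rewrite psiK.
pose s i : vertex B i :=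
  if i < m then src (z i) else if i < m + n then psi i (u (i - m))
  else src (x i).
have s_walk i : m <= i <= m + n -> s i = psi i (u (i - m)).
  move=> /andP[mi imn]; rewrite /s ltnNge mi /=.
  move: imn; rewrite leq_eqVlt => /predU1P[->|->] //.
  by rewrite ltnn addKn un phiK.
have s_z i : i <= m -> s i = src (z i).
  rewrite leq_eqVlt => /predU1P[->|im]; last by rewrite /s im.
  by rewrite s_walk ?leqnn ?leq_addr// subnn u0 phiK.
have s_x i : m + n <= i -> s i = src (x i).
  by move=> mni; rewrite /s !ltnNge mni (leq_trans (leq_addr n m) mni).
pose Q i (e : edge B i) :=
  (i < m -> e = z i) /\ (m + n <= i -> e = x i).
have [i|y yQ] := path_choice s Q; last first.
  by exists y; split=> i; case: (yQ i) => _ [].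
have [im|mi] := ltnP i m.
  exists (z i); rewrite !s_z ?(ltnW im)//; split=> //; first exact: path_edgeP.
  by split=> // mni; lia.
have [imn|mni] := ltnP i (m + n); last first.
  exists (x i); rewrite !s_x ?(leqW mni)//; split=> //; first exact: path_edgeP.
  by split=> // im; lia.
have [|e [se re]] := edge_exists i (s i) (s i.+1).
  by rewrite !s_walk ?psiK ?subSn//; [apply: uF|..]; lia.
by exists e; split=> //; split=> ?; lia.
Qed.

End Stationary.

Theorem theorem5p1 (B : gen_bratteli) (F : int -> int -> nat) :
  stationary B F ->
  irreducible_mx F ->
  aperiodic_mx F ->
  topologically_transitive (@tail_equivalent B).
Proof.
move=> [phi [phi_bij phiF]] irrF aperF.
have [p p0 /mxpow_walk loop] := irrF (Posz 0) (Posz 0).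
have [x x0] := periodic_path _ _ _ phi_bij phiF p0 loop.
exists x => O [z Oz] /open_cylinder/(_ Oz)[k zO].
have [N largeN] := walk_large F irrF aperF (phi k.+1 (src (z k.+1))) (Posz 0).
(* At level (k.+1 + N) * p the path x is at the vertex 0, and p > 0 makes this
   level at least k.+1 + N. *)
pose M := (k.+1 + N) * p.
have kNM : k.+1 + N <= M by rewrite leq_pmulr.
have ME : k.+1 + (M - k.+1) = M by lia.
have [|y [yz yx]] := @splice _ _ _ phi_bij phiF z x k.+1 (M - k.+1).
  by rewrite ME x0; apply: largeN; lia.
exists y; split; first by apply: zO => i ik; exact: yz.
by exists M => i Mi; rewrite yx// ME.
Qed.
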